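(* Let $k\geq 2$ be an integer, let $G$ be a graph, and for $d\geq 0$ let $n_d$ denote the number of vertices in $G$ with degree $d$. Let $\varepsilon_k^*:=\frac{2}{(k+1)(D^*+1)}$, where $D^*$ is the smallest integer $D\geq k+1$ such that $(k+1)\sum_{d=k+1}^{D} n_d\geq n_1$ if there is such an integer; otherwise let $\varepsilon_k^*:=0$. Then the function \[ t_{G,k}:\left[0,\tfrac{2}{(k+1)(k+2)}\right]\to\mathbb{R},\qquad \varepsilon\mapsto\sum_{v\in V(G)} f_{k,\varepsilon}(d_G(v)) \] is maximized at $\varepsilon_k^*$.
   Context: All graphs are finite, simple, and undirected; $d_G(v)$ denotes the degree of vertex $v$ in $G$; $\mathbb{N}$ includes $0$. For an integer $k\geq 2$ and a real $\varepsilon$ with $0\leq\varepsilon\leq\frac{2}{(k+1)(k+2)}$, the function $f_{k,\varepsilon}:\mathbb{N}\to[0,1]$ is defined by $f_{k,\varepsilon}(0)=1$, $f_{k,\varepsilon}(1)=1-\varepsilon$, $f_{k,\varepsilon}(d)=\frac{2}{d+1}$ for $2\leq d\leq k$, and $f_{k,\varepsilon}(d)=\min\left\{(k+1)\varepsilon,\frac{2}{d+1}\right\}$ for $d\geq k+1$. *)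

(* Defs.v *)
From mathcomp Require Import all_boot all_order all_algebra.
From mathcomp Require Import boolp reals.

Set Implicit Arguments.
Unset Strict Implicit.
Unset Printing Implicit Defensive.

Import Order.TTheory GRing.Theory Num.Theory.
Local Open Scope ring_scope.

Record sgraph := SGraph {
  vertex : finType;
  edge : rel vertex;
  edge_sym : symmetric edge;
  edge_irrefl : irreflexive edge }.

Definition deg (G : sgraph) (v : vertex G) : nat := #|[set w | edge v w]|.

Definition ndeg (G : sgraph) (d : nat) : nat :=
  #|[set v : vertex G | deg v == d]|.

Definition eps_max (R : realType) (k : nat) : R :=
  2 / (k.+1%:R * k.+2%:R).

Definition f (R : realType) (k : nat) (eps : R) (d : nat) : R :=
  match d with
  | 0%N => 1
  | 1%N => 1 - eps
  | _ => if (d <= k)%N then 2 / d.+1%:R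
         else Num.min (k.+1%:R * eps) (2 / d.+1%:R)
  end.

(* Total in [eps]; it is the intended function on the interval from 0 to
   [eps_max R k] only, where [f k eps] takes its values in [0, 1]. *)
Definition t (R : realType) (G : sgraph) (k : nat) (eps : R) : R :=
  \sum_(v : vertex G) f k eps (deg v).

Definition Dstar_cand (G : sgraph) (k : nat) : pred nat := fun D =>
  (k.+1 <= D)%N && (ndeg G 1 <= k.+1 * \sum_(k.+1 <= d < D.+1) ndeg G d)%N.

Definition eps_star (R : realType) (G : sgraph) (k : nat) : R :=
  match pselect (exists D, Dstar_cand G k D) with
  | left exD => 2 / (k.+1%:R * (ex_minn exD).+1%:R)
  | right _ => 0
  end.

(* Main.v *)
Require Import Defs.
From mathcomp Require Import all_boot all_order all_algebra.
From mathcomp Require Import boolp reals.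
From mathcomp Require Import lra.

(** On its interval the function [t G k] is concave and piecewise linear, with
    breakpoints at [2 / ((k + 1) (d + 1))] for [d > k]: a vertex of degree 1
    contributes slope [-1], and a vertex of degree [d > k] contributes slope
    [k + 1] up to the breakpoint of [d] and slope [0] beyond it.  So the slope
    between consecutive breakpoints is [(k + 1) * N - n_1], where [N] counts the
    vertices whose degree exceeds [k] and is below some threshold, and the
    threshold drops as [eps] grows.  The number [eps_star] is the breakpoint
    at which this slope changes sign: the minimal [D] with
    [(k + 1) * N >= n_1] makes the slope nonnegative to the left (degrees up to
    [D] count) and, by minimality, nonpositive to the right (only degrees
    below [D] count).

    Instead of concavity, the proof uses one chord bound, [t_chord_le], for a
    threshold [m]: applied with [m = D + 1] to the left of [eps_star], and with
    [m = D] to its right.  If no [D] exists, then [eps_star = 0] and [m] is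
    taken above all degrees. *)

Set Implicit Arguments.
Unset Strict Implicit.
Unset Printing Implicit Defensive.

Import Order.TTheory GRing.Theory Num.Theory.
Local Open Scope ring_scope.

Lemma f_large (R : realType) (k : nat) (eps : R) (d : nat) : (0 < k)%N ->
  (k < d)%N -> f k eps d = Num.min (k.+1%:R * eps) (2 / d.+1%:R).
Proof.
by case: k => // k _; case: d => [|[|d]] //= kd; rewrite leqNgt kd.
Qed.

Lemma sum_ndeg (G : sgraph) (a b : nat) :
  (\sum_(a <= d < b) ndeg G d)%N = #|[set v : vertex G | a <= deg v < b]%N|.
Proof.
rewrite -sum1_card (eq_bigl (fun v : vertex G => a <= deg v < b)%N); last first.
  by move=> v; rewrite inE.
rewrite (eq_bigr (fun d => \sum_(v : vertex G) (deg v == d))%N); last first.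
  move=> d _; rewrite /ndeg -sum1_card big_mkcond; apply: eq_bigr => v _.
  by rewrite inE; case: (_ == d).
rewrite exchange_big [RHS]big_mkcond /=; apply: eq_bigr => v _.
have [vab|vab] := ifPn.
  rewrite (bigD1_seq (deg v)) ?mem_index_iota ?iota_uniq //= eqxx.
  by rewrite big1 // => d; rewrite eq_sym => /negPf ->.
rewrite big_nat big1 // => d dab.
by case: eqP => // vd; rewrite vd dab in vab.
Qed.

(** Summing the slopes of the individual vertices: degree 1 gives exactly [-1],
    degrees 0 and [2..k] give 0, so only the degrees above [k] need a
    hypothesis.  No order between [x] and [y] is assumed, which lets the same
    bound serve both sides of the maximizer. *)
Lemma t_chord_le (R : realType) (G : sgraph) (k m : nat) (x y : R) :
    (0 < k)%N ->
    (forall d, (exists v : vertex G, deg v = d) -> (k < d)%N ->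
       f k x d - f k y d <= (x - y) * (k.+1 * (d < m))%:R) ->
  t G k x - t G k y <=
    (x - y) * ((k.+1 * \sum_(k.+1 <= d < m) ndeg G d)%:R - (ndeg G 1)%:R).
Proof.
move=> k0 fle; rewrite /t -sumrB.
have -> : (x - y) * ((k.+1 * \sum_(k.+1 <= d < m) ndeg G d)%:R
                     - (ndeg G 1)%:R)
  = \sum_(v : vertex G) (x - y) *
      ((k.+1 * (k < deg v < m))%:R - (deg v == 1)%:R).
  rewrite -mulr_sumr sumrB -!natr_sum -big_distrr /= sum_ndeg /ndeg.
  congr (_ * ((_ * _)%:R - _%:R)).
    rewrite -sum1_card big_mkcond; apply: eq_bigr => v _.
    by rewrite inE; case: ifP.
  rewrite -sum1_card big_mkcond; apply: eq_bigr => v _.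
  by rewrite inE; case: ifP.
apply: ler_sum => v _.
have [kv|vk] := ltnP k (deg v).
  have -> : (deg v == 1%N) = false by apply/eqP => v1; rewrite v1 ltnNge k0 in kv.
  by rewrite subr0; apply: fle => //; exists v.
rewrite muln0; case: (deg v) vk => [|[|d]] /= vk.
- by rewrite !subrr mulr0.
- by rewrite mulr0n mulr1n; lra.
- by rewrite vk !subrr mulr0.
Qed.

Lemma f_increment_le (R : realType) (k d : nat) (x y : R) : (0 < k)%N ->
  (k < d)%N -> y <= x -> f k x d - f k y d <= (x - y) * k.+1%:R.
Proof.
move=> k0 kd yx; rewrite !f_large //.
have Kyx : k.+1%:R * y <= k.+1%:R * x by rewrite ler_wpM2l.
rewrite mulrBl !(mulrC _ k.+1%:R).
move: (k.+1%:R * x) (k.+1%:R * y) (2 / d.+1%:R) Kyx => a b c ba.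
by case: (leP a) => ?; case: (leP b) => ?; lra.
Qed.

Lemma f_le (R : realType) (k d : nat) (x y : R) : (0 < k)%N ->
  (k < d)%N -> x <= y -> f k x d <= f k y d.
Proof.
move=> k0 kd xy; rewrite !f_large //.
have Kxy : k.+1%:R * x <= k.+1%:R * y by rewrite ler_wpM2l.
move: (k.+1%:R * x) (k.+1%:R * y) (2 / d.+1%:R) Kxy => a b c ab.
by case: (leP a) => ?; case: (leP b) => ?; lra.
Qed.

Definition breakpoint (R : realType) (k D : nat) : R :=
  2 / (k.+1%:R * D.+1%:R).

Lemma breakpointK (R : realType) (k D : nat) :
  k.+1%:R * breakpoint R k D = 2 / D.+1%:R.
Proof. by rewrite /breakpoint invfM mulrCA mulVKf // pnatr_eq0. Qed.

Lemma ler_2_div (R : realType) (d e : nat) : (d <= e)%N ->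
  2 / e.+1%:R <= 2 / d.+1%:R :> R.
Proof. by move=> de; rewrite ler_pM2l // lef_pV2 ?posrE // ler_nat. Qed.

(** Left of the breakpoint of [D], every degree in [k + 1 .. D] is still on its
    increasing branch, so these vertices lose exactly [(k + 1) (b - x)] each
    when moving from the breakpoint [b] down to [x]; vertices of larger
    degree gain nothing in this move. *)
Lemma breakpoint_left (R : realType) (G : sgraph) (k D : nat) (x : R) :
    (0 < k)%N -> Dstar_cand G k D -> x <= breakpoint R k D ->
  t G k x <= t G k (breakpoint R k D).
Proof.
move=> k0 /andP[kD n1le] xb; rewrite -subr_le0.
apply: le_trans (t_chord_le (m := D.+1) k0 _) _; last first.
  by rewrite mulr_le0_ge0 ?subr_le0 ?subr_ge0 ?ler_nat.
move=> d _ kd; rewrite ltnS; have [dD|Dd] := leqP d D; last first.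
  by rewrite muln0 mulr0 subr_le0 f_le.
rewrite muln1 !f_large // breakpointK.
have de := ler_2_div R dD.
have Kx : k.+1%:R * x <= 2 / D.+1%:R by rewrite -(breakpointK R k) ler_wpM2l.
by rewrite !min_l ?(le_trans Kx) // -(breakpointK R k) -mulrBr mulrC.
Qed.

(** Right of the breakpoint of [D], every degree at least [D] has already
    reached its cap [2 / (d + 1)] and gains nothing; only degrees in
    [k + 1 .. D - 1] may still gain, at rate at most [k + 1]. *)
Lemma breakpoint_right (R : realType) (G : sgraph) (k D : nat) (x : R) :
    (0 < k)%N -> (k.+1 * \sum_(k.+1 <= d < D) ndeg G d <= ndeg G 1)%N ->
    breakpoint R k D <= x ->
  t G k x <= t G k (breakpoint R k D).
Proof.
move=> k0 len1 bx; rewrite -subr_le0.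
apply: le_trans (t_chord_le (m := D) k0 _) _; last first.
  by rewrite mulr_ge0_le0 ?subr_le0 ?subr_ge0 ?ler_nat.
move=> d _ kd; have [dD|Dd] := ltnP d D.
  by rewrite muln1 f_increment_le.
rewrite muln0 mulr0 !f_large // breakpointK.
have de := ler_2_div R Dd.
have Kx : 2 / D.+1%:R <= k.+1%:R * x by rewrite -(breakpointK R k) ler_wpM2l.
by rewrite !min_r ?(le_trans de) // subrr.
Qed.

(** A minimal candidate [D] either is [k + 1], where the sum is empty, or has
    a predecessor that fails to be a candidate. *)
Lemma Dstar_min_sum_le (G : sgraph) (k D : nat) : Dstar_cand G k D ->
    (forall E, Dstar_cand G k E -> D <= E)%N ->
  (k.+1 * \sum_(k.+1 <= d < D) ndeg G d <= ndeg G 1)%N.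
Proof.
case: D => [|D] /andP[//]; rewrite leq_eqVlt => /orP[/eqP[->] _ _|kD _ minD].
  by rewrite big_geq // muln0.
rewrite leqNgt; apply/negP => ltn1.
by have := minD D; rewrite /Dstar_cand (kD : k < D)%N ltnn (ltnW ltn1) => /(_ isT).
Qed.

Lemma no_Dstar_max (R : realType) (G : sgraph) (k : nat) (x : R) :
  (0 < k)%N -> ~ (exists D, Dstar_cand G k D) -> 0 <= x ->
  t G k x <= t G k 0.
Proof.
move=> k0 noD x0; rewrite -subr_le0.
(* Degrees are at most the order of the graph, so every degree counts. *)
pose D := (k.+1 + #|vertex G|)%N.
apply: le_trans (t_chord_le (m := D.+1) k0 _) _ => [_ [v <-] kd|].
  have -> : (deg v < D.+1)%N.
    by rewrite ltnS (leq_trans (max_card _)) ?leq_addl.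
  by rewrite muln1 f_increment_le.
rewrite subr0 mulr_ge0_le0 // subr_le0 ler_nat leqNgt; apply/negP => ltn1.
by apply: noD; exists D; rewrite /Dstar_cand leq_addr ltnW.
Qed.

Theorem theorem9 (R : realType) (k : nat) (hk : (2 <= k)%N) (G : sgraph) :
  eps_star R G k \in `[0, eps_max R k] /\
  (forall eps : R, eps \in `[0, eps_max R k] ->
     t G k eps <= t G k (eps_star R G k)).
Proof.
have k0 : (0 < k)%N := ltnW hk.
rewrite /eps_star; case: pselect => [exD|noD]; last first.
  split=> [|x]; first by rewrite in_itv /= lexx divr_ge0 ?mulr_ge0.
  by rewrite in_itv /= => /andP[x0 _]; apply: no_Dstar_max.
case: ex_minnP => D candD minD; rewrite -/(breakpoint R k D); split.
  have /andP[kD _] := candD.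
  rewrite in_itv /= divr_ge0 ?mulr_ge0 //=.
  by rewrite -(ler_pM2l (ltr0Sn R k)) breakpointK (breakpointK _ k k.+1) ler_2_div.
move=> x _; have [xb|/ltW bx] := leP x (breakpoint R k D).
  exact: breakpoint_left.
by apply: breakpoint_right => //; apply: Dstar_min_sum_le.
Qed.
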